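(* Let $\mathbb{F}$ be a finite field. If $\mathcal{P}\subseteq\mathbb{F}^2$ is a semi-grid and $f\in\mathbb{F}[X,Y]$ is a dense polynomial satisfying either $n_X(\mathcal{P})\in O(\deg_X f)$ or $\deg_Y f\in O(\nu_Y(\mathcal{P}))$, then the algorithm $\mathsf{BivariateMPE}$ described in the context, which computes $\big(f(\alpha,\beta)\big)_{(\alpha,\beta)\in\mathcal{P}}$, has quasi-linear complexity in the input size $|\mathcal{P}|+\deg_X f\cdot\deg_Y f$.
   Context: For $\mathcal{P}\subseteq\mathbb{F}^2$: $\mathcal{X}(\mathcal{P})=\{\alpha\in\mathbb{F}\mid \exists\beta\in\mathbb{F}: (\alpha,\beta)\in\mathcal{P}\}$ and $n_X(\mathcal{P})=|\mathcal{X}(\mathcal{P})|$; for $\alpha\in\mathbb{F}$, $\mathcal{Y}_\alpha(\mathcal{P})=\{\beta\in\mathbb{F}\mid(\alpha,\beta)\in\mathcal{P}\}$; and $\nu_Y(\mathcal{P})=\max_{\alpha\in\mathcal{X}(\mathcal{P})}|\mathcal{Y}_\alpha(\mathcal{P})|$. $\mathcal{P}$ is a semi-grid if $|\mathcal{Y}_\alpha(\mathcal{P})|\in\{0,\nu_Y(\mathcal{P})\}$ for each $\alpha\in\mathbb{F}$. For finite $\mathcal{A}$, an element $T\in\mathcal{B}^{\mathcal{A}}$ is a lookup table with stored values $T[a]\in\mathcal{B}$, $a\in\mathcal{A}$. Subroutine $\mathsf{UnivariateMPE}$: the classical fast univariate multipoint evaluation algorithm. It inputs $h\in\mathbb{F}[Z]$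 and $\mathcal{S}\subseteq\mathbb{F}$ and outputs the table $(h(\alpha))_{\alpha\in\mathcal{S}}\in\mathbb{F}^{\mathcal{S}}$, using $O\big(\mathsf{M}(\deg h+|\mathcal{S}|)\log(\deg h+|\mathcal{S}|)\big)\subset\tilde{O}(\deg h+|\mathcal{S}|)$ operations in $\mathbb{F}$, where $\mathsf{M}(n)\in\tilde O(n)$ is the cost of multiplying two univariate polynomials over $\mathbb{F}$ of degree at most $n$. Algorithm $\mathsf{BivariateMPE}$. Input: $f=f_0(X)+f_1(X)Y+\cdots+f_{d_Y}(X)Y^{d_Y}\in\mathbb{F}[X,Y]$ with $f_i\in\mathbb{F}[X]$, $d_Y=\deg_Y f$, and $\mathcal{P}\subseteq\mathbb{F}^2$. 1. Compute $\mathcal{X}=\mathcal{X}(\mathcal{P})$ and the sets $\mathcal{Y}_\alpha=\mathcal{Y}_\alpha(\mathcal{P})$. 2. For $i=0,\dots,d_Y$, compute $\mathcal{F}_i=\mathsf{UnivariateMPE}(f_i,\mathcal{X})\in\mathbb{F}^{\mathcal{X}}$. 3. For each $\alpha\in\mathcal{X}$, form $g_\alpha=\sum_{i=0}^{d_Y}\mathcal{F}_i[\alpha]Y^i\in\mathbb{F}[Y]$ and compute $\mathcal{G}_\alpha=\mathsf{UnivariateMPE}(g_\alpha,\mathcal{Y}_\alpha)\in\mathbb{F}^{\mathcal{Y}_\alpha}$. 4. Return $(\mathcal{G}_\alpha[\beta])_{(\alpha,\beta)\in\mathcal{P}}$. Complexity counts basic arithmetic operations in $\mathbb{F}$ on an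 algebraic RAM model (table retrieval and insertion cost $O(1)$). Quasi-linear in $N$ means $\tilde{O}(N)$, where $\tilde{O}(h)=\bigcup_{c\ge0}O(h\log^c h)$. *)

(* Defs.v *)
From HB Require Import structures.
From mathcomp Require Import all_boot all_order all_algebra.
From mathcomp Require Import finmap.

Set Implicit Arguments.
Unset Strict Implicit.
Unset Printing Implicit Defensive.

Import GRing.Theory.
Local Open Scope fset_scope.
Local Open Scope fmap_scope.
Local Open Scope nat_scope.

(* Asymptotics of functions of a single size n, as n tends to infinity.
   The logarithm is the floor of log_2, within a factor 2 of log_2 n for
   every n >= 2. *)

Definition bigO (g h : nat -> nat) : Prop :=
  exists C n0, forall n, n0 <= n -> g n <= C * h n.

Definition softO (g h : nat -> nat) : Prop :=
  exists c, bigO g (fun n => h n * trunc_log 2 (h n) ^ c).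

(* O-relation between two parameters of the members of a family: one constant
   serves the whole family.  There is no "sufficiently large" clause, since a
   parameter may stay bounded along an infinite family. *)
Definition uniformO (I : Type) (g h : I -> nat) : Prop :=
  exists C, forall x, g x <= C * h x.

Definition quasilinear (I : Type) (cost size : I -> nat) : Prop :=
  exists2 t, softO t id & forall x, cost x <= t (size x).

(* Computations paired with the number of unit-cost operations they perform.
   Costs are charged by the primitives below and by called subroutines. *)

Definition timed (A : Type) : Type := (A * nat)%type.
Definition value (A : Type) (m : timed A) : A := m.1.
Definition time (A : Type) (m : timed A) : nat := m.2.

Definition ret (A : Type) (a : A) : timed A := (a, 0).
Definition unit_cost (A : Type) (a : A) : timed A := (a, 1).
Definition bind (A B : Type) (m : timed A) (k : A -> timed B) : timed B :=
  (value (k (value m)), time m + time (k (value m))).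

Notation "'let*' x ':=' m 'in' k" := (bind m (fun x => k))
  (at level 200, x name, m at level 100, k at level 200, right associativity,
   format "'[v' 'let*'  x  ':='  m  'in' '/' k ']'").

(* [for_each s body st]: run [body] over the items of [s], threading a state. *)
Fixpoint for_each (A S : Type) (s : seq A) (body : A -> S -> timed S) (st : S)
    : timed S :=
  if s is a :: s' then
    let* st' := body a st in for_each s' body st'
  else ret st.

(* A table in B^A, for a finite set A of keys, is a finite map with domain A. *)
Definition lookup (K : choiceType) (V : Type) (dflt : V) (T : {fmap K -> V})
  (k : K) : timed V := unit_cost (odflt dflt T.[? k]).

Definition insert (K : choiceType) (V : Type) (T : {fmap K -> V}) (k : K)
  (v : V) : timed {fmap K -> V} := unit_cost T.[k <- v].

Definition add_elt (K : choiceType) (S : {fset K}) (k : K) : timed {fset K} :=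
  unit_cost (k |` S).

Definition add_monomial (K : finFieldType) (g : {poly K}) (c : K) (i : nat)
  : timed {poly K} := unit_cost (g + c *: 'X^i)%R.

Section PointSets.
Variable K : finFieldType.
Implicit Type P : {fset K * K}.

Definition Xset P : {fset K} := [fset p.1 | p in P].
Definition Yset P (a : K) : {fset K} := [fset p.2 | p in P & p.1 == a].
Definition nX P : nat := #|` Xset P|.
Definition nuY P : nat := \max_(a <- enum_fset (Xset P)) #|` Yset P a|.

Definition semi_grid P : Prop :=
  forall a : K, #|` Yset P a| \in [:: 0; nuY P].

End PointSets.

(* f = f_0(X) + f_1(X) Y + ... is represented by f : {poly {poly K}} with
   f`_i = f_i: the OUTER indeterminate is Y and the inner one is X.  The
   library calls the inner indeterminate 'Y, so its [sizeY f], the largest of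
   the sizes of the coefficients f`_i, is here one plus the X-degree of f.
   Degrees are naturals, and the zero polynomial has degree 0. *)

Definition deg (K : finFieldType) (h : {poly K}) : nat := (size h).-1.

Section Bivariate.
Variable K : finFieldType.
Implicit Type f : {poly {poly K}}.

Definition degX f : nat := (sizeY f).-1.
Definition degY f : nat := (size f).-1.
Definition eval2 f (a b : K) : K := f.[b%:P].[a]%R.

(* Number of entries of the dense coefficient array of f: this is
   (degX f + 1) * (degY f + 1) if f != 0, and 0 if f = 0. *)
Definition dense_size f : nat := sizeY f * size f.

End Bivariate.

(* A family of dense polynomials: each f is stored as its full coefficient
   array, whose size is of the order of degX f * degY f.  Nothing is required
   of the values of the coefficients.  The condition only rules out nonzero
   polynomials in X alone or in Y alone, whose storage is not bounded in terms
   of degX f * degY f = 0. *)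
Definition dense (I : Type) (F : I -> finFieldType)
    (f : forall x, {poly {poly F x}}) : Prop :=
  uniformO (fun x => dense_size (f x)) (fun x => degX (f x) * degY (f x)).

(* A subroutine for univariate multipoint evaluation over all finite fields,
   with its specification; M n bounds the cost of multiplying two univariate
   polynomials of degree at most n. *)
Definition mpe_routine : Type :=
  forall K : finFieldType, {poly K} -> {fset K} -> timed {fmap K -> K}.

Definition fast_univariate_mpe (M : nat -> nat) (mpe : mpe_routine) : Prop :=
  (forall (K : finFieldType) (h : {poly K}) (S : {fset K}),
     value (mpe K h S) = [fmap a : S => h.[val a]%R]) /\
  (exists2 t, bigO t (fun n => M n * trunc_log 2 n) &
     forall (K : finFieldType) (h : {poly K}) (S : {fset K}),
       time (mpe K h S) <= t (deg h + #|` S|)).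

Section BivariateMPE.
Variables (mpe : mpe_routine) (K : finFieldType).
Variables (f : {poly {poly K}}) (P : {fset K * K}).

Definition step1_X : timed {fset K} :=
  for_each (enum_fset P) (fun p X => add_elt X p.1) fset0.

Definition step1_Y : timed {fmap K -> {fset K}} :=
  for_each (enum_fset P) (fun p Ys =>
    let* Y := lookup fset0 Ys p.1 in
    let* Y' := add_elt Y p.2 in
    insert Ys p.1 Y') [fmap].

Definition step2 (X : {fset K}) : timed {fmap nat -> {fmap K -> K}} :=
  for_each (iota 0 (degY f).+1) (fun i Fs =>
    let* Fi := mpe (f`_i)%R X in
    insert Fs i Fi) [fmap].

Definition step3_poly (Fs : {fmap nat -> {fmap K -> K}}) (a : K)
    : timed {poly K} :=
  for_each (iota 0 (degY f).+1) (fun i g =>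
    let* Fi := lookup [fmap] Fs i in
    let* c := lookup 0%R Fi a in
    add_monomial g c i) 0%R.

Definition step3 (X : {fset K}) (Ys : {fmap K -> {fset K}})
    (Fs : {fmap nat -> {fmap K -> K}}) : timed {fmap K -> {fmap K -> K}} :=
  for_each (enum_fset X) (fun a Gs =>
    let* g := step3_poly Fs a in
    let* Y := lookup fset0 Ys a in
    let* G := mpe g Y in
    insert Gs a G) [fmap].

Definition step4 (Gs : {fmap K -> {fmap K -> K}}) : timed {fmap K * K -> K} :=
  for_each (enum_fset P) (fun p out =>
    let* G := lookup [fmap] Gs p.1 in
    let* v := lookup 0%R G p.2 in
    insert out p v) [fmap].

Definition BivariateMPE : timed {fmap K * K -> K} :=
  let* X := step1_X in
  let* Ys := step1_Y in
  let* Fs := step2 X in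
  let* Gs := step3 X Ys Fs in
  step4 Gs.

End BivariateMPE.

(* Main.v *)
Require Import Defs.
From mathcomp Require Import all_boot all_order all_algebra.
From mathcomp Require Import finmap zify.

Set Implicit Arguments.
Unset Strict Implicit.
Unset Printing Implicit Defensive.

Import GRing.Theory.
Local Open Scope fset_scope.
Local Open Scope fmap_scope.
Local Open Scope nat_scope.

(** Correctness is Horner evaluation in two stages: f(a, b) = g_a(b) where the
    coefficients of g_a are the values f_i(a).

    For the complexity, let N be the input size plus 1, n the number nX of
    distinct abscissas and m the common size nuY of the nonempty fibers.
    Up to constant factors, and for a univariate evaluation cost T, the running
    time is
      |P| + (degY f + 1) (1 + T (degX f + n)) + n (degY f + 1 + T (degY f + m)).
    With T quasi-linear, this is quasi-linear in the sum of the products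
    (degX f + 1) (degY f + 1), n m, n and n degY f.  The first is O(N) because f
    is dense, the second equals |P| because P is a semi-grid ([semi_grid_card]),
    and n <= |P|.  The mixed product n degY f is where the size condition
    enters: it is O(degX f degY f) if n is O(degX f), and O(n m) = O(|P|) if
    degY f is O(m) ([grid_arith]).

    The sizes to which the univariate subroutine is applied may stay small
    while N grows, so asymptotic bounds on its cost do not apply directly.
    They are first turned into bounds valid for all sizes, of the monotone form
    D (n + 1) (1 + log n)^k ([mpe_cost_bound]), and only the total cost is
    turned back into an asymptotic bound ([softO_ell]). *)

(** * Quasi-linear bounds valid for all sizes *)

(** The successor makes this positive, so that its powers can bound cost
    functions at the sizes 0 and 1 as well. *)
Definition ell (n : nat) : nat := (trunc_log 2 n).+1.

Lemma leq_ell m n : m <= n -> ell m <= ell n.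
Proof. by move=> le_mn; rewrite ltnS leq_trunc_log. Qed.

(** The finitely many values below the threshold are absorbed into the
    constant, since [h] is at least 1 there. *)
Lemma bigO_everywhere g h : bigO g h -> (forall n, 0 < h n) ->
  exists C, forall n, g n <= C * h n.
Proof.
move=> [C [n0 gh]] h_gt0; exists (C + \sum_(i < n0) g i) => n.
have [lt_n|le_n] := ltnP n n0; last first.
  by rewrite mulnDl (leq_trans (gh n le_n)) ?leq_addr.
rewrite (leq_trans _ (leq_pmulr _ (h_gt0 n))) // (bigD1 (Ordinal lt_n)) //=.
by rewrite addnCA leq_addr.
Qed.

(** The extra factor [trunc_log 2 n] raises the exponent of the logarithm in the
    bound on [M] by one. *)
Lemma mpe_cost_bound M t : softO M id ->
  bigO t (fun n => M n * trunc_log 2 n) ->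
  exists D k, forall n, t n <= D * (n.+1 * ell n ^ k).
Proof.
move=> [c [C [n0 M_le]]] [C' [n1 t_le]].
have t_bigO: bigO t (fun n => n.+1 * ell n ^ c.+1).
  exists (C' * C), (maxn n0 n1) => n; rewrite geq_max => /andP[n0n n1n].
  apply: leq_trans (t_le n n1n) _; rewrite -mulnA leq_mul2l; apply/orP; right.
  apply: leq_trans (leq_mul (M_le n n0n) (leqnn _)) _.
  rewrite -!mulnA leq_mul2l -expnSr; apply/orP; right.
  by rewrite leq_mul // leq_exp2r.
have [n|D le_D] := bigO_everywhere t_bigO; last by exists D, c.+1.
by rewrite muln_gt0 expn_gt0.
Qed.

(** The logarithm of [A * n] is at most [A] plus that of [n], because
    [A < 2 ^ A]. *)
Lemma ell_mul A n : 0 < n -> ell (A * n) <= A.+1 * ell n.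
Proof.
move=> n_gt0; rewrite /ell.
have [/eqP|An_gt0] := posnP (A * n).
  by rewrite muln_eq0 => /orP[]/eqP e; [rewrite e mul0n trunc_log0 mul1n|lia].
have lt_pow: A * n < 2 ^ (A + (trunc_log 2 n).+1).
  rewrite expnD ltn_mul ?trunc_log_ltn //; exact: ltn_expl.
have: trunc_log 2 (A * n) < A + (trunc_log 2 n).+1.
  rewrite -(ltn_exp2l _ _ (isT : 1 < 2)).
  by apply: leq_ltn_trans lt_pow; apply: trunc_logP.
nia.
Qed.

(** For [n >= 2], [n.+1] is at most [2 * n] and [ell n] at most twice the
    logarithm of [n], which leaves only constant factors. *)
Lemma softO_ell E A k : softO (fun n => E * (n.+1 * ell (A * n.+1) ^ k)) id.
Proof.
exists k, (E * (2 * ((A * 2).+1 * 2) ^ k)), 2 => n n_ge2.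
have log_gt0: 0 < trunc_log 2 n by rewrite trunc_log_gt0.
have le_ell: ell (A * n.+1) <= (A * 2).+1 * 2 * trunc_log 2 n.
  apply: leq_trans (_ : ell (A * 2 * n) <= _).
    by apply: leq_ell; rewrite -mulnA leq_mul2l; lia.
  apply: leq_trans (ell_mul _ _) _; first by lia.
  by rewrite -mulnA leq_mul2l /ell; apply/orP; right; lia.
rewrite -!mulnA leq_mul2l; apply/orP; right.
rewrite (mulnCA _ n) mulnA -expnMn leq_mul //; first lia.
by case: k => // k; rewrite leq_exp2r.
Qed.

(** * Loops *)

Lemma time_for_each (A : eqType) (S : Type) (s : seq A)
    (body : A -> S -> timed S) c st :
  (forall a st, a \in s -> time (body a st) <= c) ->
  time (for_each s body st) <= size s * c.
Proof.
elim: s st => // a s IHs st body_le /=.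
rewrite mulSn leq_add ?body_le ?mem_head // IHs // => b st' s_b.
by rewrite body_le // in_cons s_b orbT.
Qed.

Lemma fnd_fmap_fset (L : choiceType) (V : Type) (S : {fset L}) (v : L -> V) k :
  [fmap a : S => v (val a)].[? k] = if k \in S then Some (v k) else None.
Proof.
have [S_k|S'k] := boolP (k \in S); last by rewrite not_fnd.
by rewrite in_fnd ffunE.
Qed.

(** Every write under a key stores the same value, so neither the order of [s]
    nor repetitions in it matter.  The body is described only on items of [s],
    because step 4 reads values that are stored just for points of the point
    set. *)
Lemma fnd_for_each_insert (K : choiceType) (V : Type) (s : seq K)
    (body : K -> {fmap K -> V} -> timed {fmap K -> V}) (v : K -> V) T k :
  (forall a T, a \in s -> value (body a T) = T.[a <- v a]) ->
  (value (for_each s body T)).[? k] = if k \in s then Some (v k) else T.[? k].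
Proof.
elim: s T => // a s IHs T body_v.
transitivity (value (for_each s body (value (body a T)))).[? k] => //.
rewrite IHs => [|b U s_b]; last by rewrite body_v // in_cons s_b orbT.
rewrite body_v ?mem_head // fnd_set in_cons.
by case: eqP => [->|]; case: ifP.
Qed.

(** * Counting points by fibers *)

Section PointSetCounting.
Variables (K : finFieldType) (P : {fset K * K}).

Lemma mem_Yset a b : (b \in Yset P a) = ((a, b) \in P).
Proof.
apply/imfsetP/idP => /= [[[x y]]|P_ab].
  by rewrite !inE /= => /andP[P_xy /eqP <-] ->.
by exists (a, b); rewrite //= !inE P_ab /=.
Qed.

Lemma leq_nX_card : nX P <= #|` P|.
Proof. exact: leq_imfset_card. Qed.

Lemma card_fibers : #|` P| = \sum_(a <- Xset P) #|` Yset P a|.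
Proof.
rewrite card_fset_sum1 (partition_big_imfset _ (fun p => p.1)) /=.
apply: eq_bigr => a _; rewrite big_fset_condE -card_fset_sum1.
rewrite [LHS]card_imfset // [RHS]card_in_imfset //=.
by move=> [a1 b1] [a2 b2] /andP[_ /= /eqP->] /andP[_ /= /eqP->] ->.
Qed.

Lemma leq_nuY_card : nuY P <= #|` P|.
Proof.
apply/bigmax_leqP_seq => a P_a _.
by rewrite card_fibers (big_rem a) //= leq_addr.
Qed.

(** The maximum defining [nuY] ranges over [Xset P] only, but outside [Xset P]
    the fiber is empty. *)
Lemma leq_Yset_nuY a : #|` Yset P a| <= nuY P.
Proof.
have [P_a|P'a] := boolP (a \in Xset P).
  exact: (leq_bigmax_seq (F := fun a => #|` Yset P a|)).
suff -> : Yset P a = fset0 by rewrite cardfs0.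
apply/fsetP=> b; rewrite mem_Yset inE; apply: contraNF P'a => P_ab.
by apply/imfsetP; exists (a, b).
Qed.

(** A fiber over a point of [Xset P] is nonempty, so in a semi-grid its size is
    [nuY P]. *)
Lemma semi_grid_card : semi_grid P -> nX P * nuY P = #|` P|.
Proof.
move=> gridP; rewrite card_fibers big_seq (eq_bigr (fun=> nuY P)) => [|a P_a].
  by rewrite -big_seq big_const_seq count_predT iter_addn_0 mulnC.
have:= gridP a; rewrite !inE => /orP[|/eqP//].
rewrite cardfs_eq0 => /eqP Y0.
have /imfsetP[[x b] /= P_xb a_x] := P_a.
by have:= mem_Yset a b; rewrite Y0 inE a_x P_xb.
Qed.

End PointSetCounting.

Lemma leq_deg_degX (K : finFieldType) (f : {poly {poly K}}) i :
  deg f`_i%R <= degX f.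
Proof. by rewrite /deg /degX -!subn1 leq_sub2r ?max_size_coefXY. Qed.

(** * Correctness and running time of the algorithm *)

Section Algorithm.
Variables (M : nat -> nat) (mpe : mpe_routine).
Hypothesis mpe_fast : fast_univariate_mpe M mpe.
Variables (K : finFieldType) (f : {poly {poly K}}) (P : {fset K * K}).

Lemma value_step1_X : value (step1_X P) = Xset P.
Proof.
suff valueE s X : value (for_each s (fun p X => add_elt X p.1) X) =i
    [predU [pred a | a \in [seq p.1 | p : K * K <- s]] & X].
  apply/fsetP=> a; rewrite valueE !inE orbF.
  by apply/mapP/imfsetP => -[p P_p ->]; exists p.
elim: s X => //= p s IHs X a; rewrite IHs !inE.
by rewrite orbA [(_ == _) || _]orbC.
Qed.

(** The loop accumulates into the entries of its table instead of writing each
    key once, so the invariant describes the membership of each [b] in the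
    entry of [a]. *)
Lemma value_step1_Y a : odflt fset0 (value (step1_Y P)).[? a] = Yset P a.
Proof.
suff valueE (s : seq (K * K)) T b :
    b \in odflt fset0 (value (for_each s (fun p Ys =>
      let* Y := lookup fset0 Ys p.1 in
      let* Y' := add_elt Y p.2 in insert Ys p.1 Y') T)).[? a]
    = ((a, b) \in s) || (b \in odflt fset0 T.[? a]).
  by apply/fsetP=> b; rewrite valueE fnd_fmap0 in_fset0 orbF mem_Yset.
elim: s T => //= -[x y] s IHs T; rewrite IHs fnd_set in_cons xpair_eqE.
have [->|_] /= := eqVneq a x; last by [].
by rewrite !inE orbCA orbA.
Qed.

Lemma fnd_step2 X i : i <= degY f ->
  (value (step2 mpe f X)).[? i] = Some [fmap a : X => (f`_i).[val a]%R].
Proof.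
move=> le_i; rewrite (@fnd_for_each_insert _ _ _ _
  (fun i => [fmap a : X => (f`_i).[val a]%R])) => [|j T _ /=].
  by rewrite mem_iota /= add0n ltnS le_i.
by have [-> _] := mpe_fast.
Qed.

Lemma value_step3_poly Fs a : value (step3_poly f Fs a) =
  (\poly_(i < (degY f).+1) odflt 0 (odflt [fmap] Fs.[? i]).[? a])%R.
Proof.
rewrite poly_def -(big_mkord predT
  (fun i => odflt 0 (odflt [fmap] Fs.[? i]).[? a] *: 'X^i)%R).
suff valueE s g : value (for_each s (fun i g =>
      let* Fi := lookup [fmap] Fs i in
      let* c := lookup 0%R Fi a in add_monomial g c i) g) =
    (g + \sum_(i <- s) odflt 0 (odflt [fmap] Fs.[? i]).[? a] *: 'X^i)%R.
  by rewrite /step3_poly valueE add0r /index_iota subn0.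
elim: s g => [|i s IHs] g /=; first by rewrite big_nil addr0.
by rewrite IHs big_cons addrA.
Qed.

(** Whatever the table holds, only monomials of degree at most [degY f] are
    added; this bounds the cost of the evaluations in step 3. *)
Lemma deg_step3_poly Fs a : deg (value (step3_poly f Fs a)) <= degY f.
Proof.
by rewrite value_step3_poly /deg -subn1 leq_subLR add1n size_poly.
Qed.

(** Evaluating [f] at the constant polynomial [b%:P] and then at [a] is the same
    as evaluating each coefficient at [a] and then the resulting polynomial
    at [b]. *)
Lemma horner_step3_poly (X : {fset K}) a b : a \in X ->
  (value (step3_poly f (value (step2 mpe f X)) a)).[b]%R = eval2 f a b.
Proof.
move=> X_a; rewrite value_step3_poly horner_poly /eval2.
(* [f] may be 0, and then [(degY f).+1] exceeds [size f] by one. *)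
rewrite (horner_coef_wide b%:P (leqSpred (size f))) horner_sum.
apply: eq_bigr => i _; rewrite (@fnd_step2 X i (ltn_ord i)) /=.
rewrite (@fnd_fmap_fset _ _ X (horner f`_i)%R) X_a /=.
by rewrite -rmorphXn /= hornerM hornerC.
Qed.

Lemma value_BivariateMPE :
  value (BivariateMPE mpe f P) =
    [fmap p : P => eval2 f (val p).1 (val p).2].
Proof.
rewrite /BivariateMPE /=; set Gs := value (step3 _ _ _ _ _).
apply/fmapP => p; rewrite (fnd_fmap_fset _ (fun p => eval2 f p.1 p.2)).
rewrite (@fnd_for_each_insert _ _ _ _ (fun p => eval2 f p.1 p.2))
  => [|[a b] T P_ab /=].
  by rewrite fnd_fmap0.
congr _.[_ <- _].
have X_a: a \in Xset P by apply/imfsetP; exists (a, b).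
rewrite /Gs (@fnd_for_each_insert _ _ _ _ (fun a =>
  [fmap b : Yset P a => eval2 f a (val b)])) => [|a' T' X_a' /=].
  rewrite value_step1_X X_a /= (fnd_fmap_fset _ (eval2 f a)).
  by rewrite mem_Yset P_ab.
have [-> _] := mpe_fast; rewrite value_step1_Y; congr _.[_ <- _].
apply/fmapP=> b'; rewrite (fnd_fmap_fset _ (eval2 f a')).
by rewrite (fnd_fmap_fset _ (horner _)) horner_step3_poly.
Qed.

Variable t : nat -> nat.
Hypothesis t_mono : {homo t : m n / m <= n}.
Hypothesis time_mpe : forall (K : finFieldType) (h : {poly K}) S,
  time (mpe h S) <= t (deg h + #|` S|).

(** Step 1 costs 1 per point for the abscissas and 3 for the fibers, and step 4
    costs 3 per point.  The polynomials given to the subroutine may have smaller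
    degree than [degX f] or [degY f], so the bound needs [t] to be monotone. *)
Lemma time_BivariateMPE :
  time (BivariateMPE mpe f P) <=
    7 * #|` P| + (degY f).+1 * (t (degX f + nX P)).+1
    + nX P * (3 * (degY f).+1 + t (degY f + nuY P) + 2).
Proof.
have step1_X_le: time (step1_X P) <= #|` P| * 1 by apply: time_for_each.
have step1_Y_le: time (step1_Y P) <= #|` P| * 3 by apply: time_for_each.
have step2_le: time (step2 mpe f (Xset P))
    <= (degY f).+1 * (t (degX f + nX P)).+1.
  rewrite -[X in _ <= X * _](size_iota 0); apply: time_for_each => i T _ /=.
  rewrite addn1 ltnS; apply: leq_trans (time_mpe _ _) (t_mono _).
  by rewrite leq_add2r leq_deg_degX.
have step3_poly_le Fs a : time (step3_poly f Fs a) <= (degY f).+1 * 3.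
  by rewrite -[X in _ <= X * _](size_iota 0); apply: time_for_each.
have step3_le Fs : time (step3 mpe f (Xset P) (value (step1_Y P)) Fs)
    <= nX P * (3 * (degY f).+1 + t (degY f + nuY P) + 2).
  apply: time_for_each => a T _.
  (* Simplification would unfold the loop in [step3_poly]. *)
  rewrite -[X in X <= _]/(time (step3_poly f Fs a) +
    (1 + (time (mpe (value (step3_poly f Fs a))
                    (odflt fset0 (value (step1_Y P)).[? a])) + 1))).
  rewrite value_step1_Y.
  have mpe_le: time (mpe (value (step3_poly f Fs a)) (Yset P a))
      <= t (degY f + nuY P).
    apply: leq_trans (time_mpe _ _) (t_mono _).
    by rewrite leq_add ?deg_step3_poly ?leq_Yset_nuY.
  by move: mpe_le (step3_poly_le Fs a); lia.
have step4_le Gs : time (step4 P Gs) <= #|` P| * 3 by apply: time_for_each.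
set Fs := value (step2 mpe f (Xset P)).
set Gs := value (step3 mpe f (Xset P) (value (step1_Y P)) Fs).
have -> : time (BivariateMPE mpe f P) = time (step1_X P) + (time (step1_Y P)
    + (time (step2 mpe f (Xset P)) + (time (step3 mpe f (Xset P)
    (value (step1_Y P)) Fs) + time (step4 P Gs)))).
  by rewrite /Gs /Fs -value_step1_X.
move: step1_X_le step1_Y_le step2_le (step3_le Fs) (step4_le Gs); lia.
Qed.

End Algorithm.

(** * Products of degrees and point counts *)

(** All four quantities are sums of products each bounded by a multiple of [N].
    The one that the other hypotheses leave open is [dy * nx]: the alternative
    bounds it by [C1 * (dx * dy)] or by [C1 * (nx * nu)]. *)
Lemma grid_arith C C1 p nx nu dx dy :
  nx <= p -> nu <= p -> nx * nu <= p ->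
  dx.+1 * dy.+1 <= (C * (dx * dy)).+1 ->
  nx <= C1 * dx \/ dy <= C1 * nu ->
  let A := C + C1 + 3 in let N := (p + dx * dy).+1 in
  [/\ (dx + nx).+1 <= A * N, (dy + nu).+1 <= A * N,
      dy.+1 * (dx + nx).+1 <= A * N & nx * (dy + nu).+1 <= A * N].
Proof.
move=> nx_le nu_le grid_le dense_le cond A N.
have mixed_le: dy * nx <= C1 * N.
  by rewrite /N; case: cond => cond; nia.
split; rewrite /A /N in mixed_le *; nia.
Qed.

(** The dense size of a nonzero [f] is exactly the left-hand side; the added 1
    covers [f = 0], where both degrees are 0. *)
Lemma dense_size_bound (K : finFieldType) (f : {poly {poly K}}) C :
  dense_size f <= C * (degX f * degY f) ->
  (degX f).+1 * (degY f).+1 <= (C * (degX f * degY f)).+1.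
Proof.
have [->|f_nz] := eqVneq f 0%R.
  have /eqP sizeY0: sizeY (0 : {poly {poly K}})%R == 0 by rewrite sizeY_eq0.
  by rewrite /degX /degY sizeY0 size_poly0 muln0.
have szY: 0 < sizeY f by rewrite lt0n sizeY_eq0.
have sz: 0 < size f by rewrite size_poly_gt0.
by rewrite /dense_size /degX /degY !prednK // => /leqW.
Qed.

(** * The quasi-linear bound *)

Theorem mainTheorem2
  (M : nat -> nat) (mpe : mpe_routine)
  (M_quasilinear : softO M id)
  (mpe_fast : fast_univariate_mpe M mpe)
  (I : Type) (F : I -> finFieldType)
  (P : forall x : I, {fset (F x * F x)%type})
  (f : forall x : I, {poly {poly F x}})
  (P_semi_grid : forall x : I, semi_grid (P x))
  (f_dense : dense f)
  (size_cond :
     uniformO (fun x => nX (P x)) (fun x => degX (f x)) \/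
     uniformO (fun x => degY (f x)) (fun x => nuY (P x))) :
  (forall x : I, value (BivariateMPE mpe (f x) (P x)) =
     [fmap p : P x => eval2 (f x) (val p).1 (val p).2]%fmap) /\
  quasilinear (fun x => time (BivariateMPE mpe (f x) (P x)))
              (fun x => #|` P x|%fset + degX (f x) * degY (f x)).
Proof.
split=> [x|]; first exact: (value_BivariateMPE mpe_fast).
have [_ [t t_bigO time_mpe]] := mpe_fast.
have [D [k t_le]] := mpe_cost_bound M_quasilinear t_bigO.
pose T n := D * (n.+1 * ell n ^ k).
have ell_mono m n : m <= n -> ell m ^ k <= ell n ^ k.
  by move=> le_mn; case: (k) => // j; rewrite leq_exp2r // leq_ell.
have T_mono: {homo T : m n / m <= n}.
  by move=> m n le_mn; rewrite leq_mul2l leq_mul ?orbT ?ell_mono.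
have [C dense_le] := f_dense.
have [C1 cond_le]: exists C1, forall x,
    nX (P x) <= C1 * degX (f x) \/ degY (f x) <= C1 * nuY (P x).
  by case: size_cond => -[C1 le]; exists C1 => x; [left|right].
pose A := C + C1 + 3; pose E := 7 + 6 * A + 2 * (D * A).
exists (fun n => E * (n.+1 * ell (A * n.+1) ^ k)); first exact: softO_ell.
move=> x; have time_T (K : finFieldType) (h : {poly K}) S :
    time (mpe K h S) <= T (deg h + #|` S|).
  exact: leq_trans (time_mpe _ _ _) (t_le _).
apply: leq_trans (time_BivariateMPE (f x) (P x) T_mono time_T) _.
have [||||] := @grid_arith C C1 #|` P x|
  (nX (P x)) (nuY (P x)) (degX (f x)) (degY (f x)) _ _ _ _ (cond_le x).
- exact: leq_nX_card.
- exact: leq_nuY_card.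
- by rewrite semi_grid_card.
- exact: dense_size_bound.
rewrite -/A; set N := (#|` P x| + _).+1 => dx_le dy_le step2_le step3_le.
(* All calls of the subroutine have size below [A * N], so [W] bounds every
   logarithmic factor that occurs. *)
set W := ell (A * N) ^ k.
have W_gt0: 0 < W by rewrite expn_gt0.
have T_le n : n.+1 <= A * N -> T n <= D * (n.+1 * W).
  by move=> le_n; rewrite !leq_mul // ell_mono // ltnW.
have T_step2: (degY (f x)).+1 * T (degX (f x) + nX (P x)) <= D * (A * N) * W.
  apply: leq_trans (leq_mul (leqnn _) (T_le _ dx_le)) _.
  by rewrite mulnCA -mulnA leq_mul // mulnA leq_mul.
have T_step3: nX (P x) * T (degY (f x) + nuY (P x)) <= D * (A * N) * W.
  apply: leq_trans (leq_mul (leqnn _) (T_le _ dy_le)) _.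
  by rewrite mulnCA -mulnA leq_mul // mulnA leq_mul.
have card_le: #|` P x| <= N by rewrite /N; lia.
have le_W m : m <= m * W by rewrite leq_pmulr.
(* Each of the two families of calls contributes [D * (A * N) * W]; the other
   operations in steps 2 and 3 number at most [A * N] and [5 * (A * N)]. *)
apply: leq_trans (_ : 7 * N + 6 * (A * N) + 2 * (D * (A * N) * W) <= _).
  rewrite mulnSr !mulnDr; nia.
have := le_W (7 * N + 6 * (A * N)); rewrite /E.
clear; nia.
Qed.
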